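(* Let $u,w\in\mathcal{D}(E)$ be such that $T=M_wEM_u$, $T(f)=wE(uf)$, is a bounded operator on $L^2(\Sigma)$. If $T$ is invertible, then $T$ is normal.
   Context: $(X,\Sigma,\mu)$ is a complete $\sigma$-finite measure space and $\mathcal{A}\subseteq\Sigma$ is a sub-$\sigma$-algebra such that $\mu|_{\mathcal{A}}$ is $\sigma$-finite; functions are complex-valued, $L^2(\Sigma)=L^2(X,\Sigma,\mu)$, and all statements about functions and sets hold up to $\mu$-null sets. $L^0(\Sigma)$ (resp. $L^0(\mathcal{A})$) is the space of classes of a.e. finite-valued $\Sigma$-measurable (resp. $\mathcal{A}$-measurable) functions. $E=E^{\mathcal{A}}$ is the conditional expectation with respect to $\mathcal{A}$: $E(f)$ is the unique $\mathcal{A}$-measurable function with $\int_A f\,d\mu=\int_A E(f)\,d\mu$ for all $A\in\mathcal{A}$ for nonnegative measurable $f$ (values in $[0,\infty]$), similarly for $f\in L^2(\Sigma)$ (for $A$ of finite measure), and extended by linearity to $\mathcal{D}(E)=\{g\in L^0(\Sigma): E(|g|)\in L^0(\mathcal{A})\}$. $M_u$, $M_w$ denote multiplication by $u$, $w$, and $M_wEM_u$ is the operator $f\mapsto wE(uf)$; boundedness on $L^2(\Sigma)$ means in particular that $uf\in\mathcal{D}(E)$ for all $f\in L^2(\Sigma)$. *)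

(* Defs.v *)
From HB Require Import structures.
From mathcomp Require Import all_boot all_order all_algebra.
From mathcomp Require Import all_classical all_reals all_analysis.
From mathcomp Require Import measurable_realfun complex.

Set Implicit Arguments.
Unset Strict Implicit.
Unset Printing Implicit Defensive.

Import Order.TTheory GRing.Theory Num.Theory.
Import numFieldNormedType.Exports.

Local Open Scope classical_set_scope.
Local Open Scope ring_scope.
Local Open Scope complex_scope.

(* Elements of L^0 and L^2 are represented by functions, and operators on them
   by maps on functions; identification is up to equality mu-a.e. *)

Section ComplexL2.
Context d (X : measurableType d) (R : realType).
Variable mu : {measure set X -> \bar R}.
Implicit Types (f g : X -> R[i]) (S T : (X -> R[i]) -> X -> R[i]).

(* The library has no Borel sigma-algebra on R[i]: measurability is that of
   the real and imaginary parts. *)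
Definition cmeasurable f : Prop :=
  measurable_fun setT (fun x => complex.Re (f x)) /\
  measurable_fun setT (fun x => complex.Im (f x)).

(* The norm `|z| of R[i] takes its values in R[i]; this is the R-valued one. *)
Definition cabs f : X -> \bar R := fun x => (Normc.normc (f x))%:E.

Definition L2norm f : \bar R := ('N[mu]_(2%:E)[cabs f])%E.

Definition inL2 f : Prop := cmeasurable f /\ (L2norm f < +oo)%E.

Definition inner f g : R[i] :=
  let h x := f x * conjc (g x) in
  (\int[mu]_x complex.Re (h x)) +i* (\int[mu]_x complex.Im (h x)).

Definition bounded_operator T : Prop :=
  [/\ forall f, inL2 f -> inL2 (T f),
      forall f g, inL2 f -> inL2 g -> f = g %[ae mu] -> T f = T g %[ae mu],
      forall (a b : R[i]) f g, inL2 f -> inL2 g ->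
        T (fun x => a * f x + b * g x) =
          (fun x => a * T f x + b * T g x) %[ae mu] &
      exists M : R, forall f, inL2 f -> (L2norm (T f) <= M%:E * L2norm f)%E].

Definition invertible_operator T : Prop :=
  exists S, bounded_operator S /\
    forall f, inL2 f -> S (T f) = f %[ae mu] /\ T (S f) = f %[ae mu].

Definition adjoint T S : Prop :=
  bounded_operator S /\
  forall f g, inL2 f -> inL2 g -> inner (T f) g = inner f (S g).

(* The adjoint of a bounded operator exists and is unique up to equality a.e.,
   so quantifying over it existentially or universally is the same. *)
Definition normal_operator T : Prop :=
  exists S, adjoint T S /\
    forall f, inL2 f -> T (S f) = S (T f) %[ae mu].

End ComplexL2.

Section ConditionalExpectation.
Context d (X : measurableType d) (R : realType).
Variable (mu : {measure set X -> \bar R}) (A : set_system X).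

Definition is_sub_sigma_algebra : Prop :=
  sigma_algebra setT A /\ A `<=` (@measurable d X).

(* [g_sigma_algebraType A] is X equipped with the sigma-algebra generated by A,
   which is A itself when A is a sigma-algebra. *)
Definition sigma_finite_on : Prop :=
  sigma_finite (setT : set (g_sigma_algebraType A))
    (mu : set (g_sigma_algebraType A) -> \bar R).

Definition is_condexp (f g : X -> \bar R) : Prop :=
  [/\ measurable_fun setT (g : g_sigma_algebraType A -> \bar R),
      forall x, (0 <= g x)%E &
      forall B, A B -> (\int[mu]_(x in B) f x = \int[mu]_(x in B) g x)%E].

(* A version of E(f) for f nonnegative and measurable; one exists when mu is
   sigma-finite on A. *)
Definition condexp_ge0 (f : X -> \bar R) : X -> \bar R :=
  xget (cst +oo%E) [set g | is_condexp f g].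

Definition in_dom_condexp (f : X -> R[i]) : Prop :=
  cmeasurable f /\ {ae mu, forall x, (condexp_ge0 (cabs f) x < +oo)%E}.

(* The extension by linearity of condexp_ge0. On the domain of E the values to
   which fine is applied are finite a.e. *)
Definition condexp_real (f : X -> R) : X -> R := fun x =>
  fine (condexp_ge0 (EFin \o f^\+) x) - fine (condexp_ge0 (EFin \o f^\-) x).

Definition condexp (f : X -> R[i]) : X -> R[i] := fun x =>
  condexp_real (fun y => complex.Re (f y)) x +i*
  condexp_real (fun y => complex.Im (f y)) x.

Definition weighted_condexp (w u f : X -> R[i]) : X -> R[i] := fun x =>
  w x * condexp (fun y => u y * f y) x.

Definition bounded_weighted_condexp (w u : X -> R[i]) : Prop :=
  (forall f, inL2 mu f -> in_dom_condexp (fun x => u x * f x)) /\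
  bounded_operator mu (weighted_condexp w u).

End ConditionalExpectation.

(* Main.v *)
Require Import Defs.
From mathcomp Require Import all_boot all_order all_algebra.
From mathcomp Require Import all_classical all_reals all_analysis.
From mathcomp Require Import measurable_realfun complex.

(** Every value of T = M_w E M_u has the form w h with h measurable for the
sub-sigma-algebra A, so a surjective T can exist only if A already exhausts the
whole sigma-algebra up to null sets.  Indeed, writing 1_F = w h for sets F of
finite measure shows that w <> 0 a.e., and then 1_B = w h gives
B = {h <> 0} a.e., a set of A
([weighted_condexp_onto_ae_equal]).  A set of infinite measure is a countable
union of sets of finite measure.

Once A agrees with the whole sigma-algebra modulo null sets, a measurable
function coincides a.e. with an A-measurable one, so the conditional expectation
is the identity ([condexp_id]) and T is the multiplication by v = w u.  Such an
operator is normal ([multiplication_operator_normal]): its adjoint is the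
multiplication by the conjugate of v, which has the same norm on each function,
and multiplications commute. *)

Import Order.TTheory GRing.Theory Num.Theory.

Local Open Scope classical_set_scope.
Local Open Scope ring_scope.
Local Open Scope complex_scope.

Set Implicit Arguments.
Unset Strict Implicit.
Unset Printing Implicit Defensive.

(** * Measurability for a sub-sigma-algebra *)

Definition ae_equal_sigma_algebra d (X : measurableType d) (R : realType)
    (mu : {measure set X -> \bar R}) (A : set_system X) : Prop :=
  forall B, measurable B ->
    exists2 B', A B' & {ae mu, forall x, B x <-> B' x}.

(** The ascription changes the sigma-algebra carried by the domain from that of
[X] to the one generated by [A]. *)
Definition fun_measurable_for dX (X : measurableType dX) d (Y : measurableType d)
    (A : set_system X) (f : X -> Y) : Prop :=
  measurable_fun setT (f : g_sigma_algebraType A -> Y).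

Lemma fun_measurable_forW d (X : measurableType d) d' (Y : measurableType d')
    (A : set_system X) (f : X -> Y) :
  A `<=` measurable -> fun_measurable_for A f -> measurable_fun setT f.
Proof.
move=> AX mf _ B mB; rewrite setTI.
have := mf measurableT B mB; rewrite setTI.
exact: (smallest_sub (@sigma_algebra_measurable _ X) AX).
Qed.

(** The default value chosen when no conditional expectation exists is a constant,
hence measurable for [A] as well. *)
Lemma condexp_ge0_measurable d (X : measurableType d) (R : realType)
    (mu : {measure set X -> \bar R}) (A : set_system X) (f : X -> \bar R) :
  fun_measurable_for A (condexp_ge0 mu A f).
Proof.
rewrite /condexp_ge0; case: xgetP => [g _ []//|_].
exact: measurable_cst.
Qed.

Lemma condexp_real_measurable d (X : measurableType d) (R : realType)
    (mu : {measure set X -> \bar R}) (A : set_system X) (f : X -> R) :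
  fun_measurable_for A (condexp_real mu A f).
Proof.
apply: measurable_funB; apply: measurableT_comp => //;
  exact: condexp_ge0_measurable.
Qed.

(** This is the source of the sets of [A] that approximate arbitrary measurable
sets. *)
Lemma condexp_neq0_measurable d (X : measurableType d) (R : realType)
    (mu : {measure set X -> \bar R}) (A : set_system X) (f : X -> R[i]) :
  sigma_algebra setT A -> A [set x | condexp mu A f x != 0].
Proof.
move=> sA; rewrite -[X in X _](sigma_algebra_id sA).
have : fun_measurable_for A (fun x => complex.Im (condexp mu A f x)).
  exact: condexp_real_measurable.
have : fun_measurable_for A (fun x => complex.Re (condexp mu A f x)).
  exact: condexp_real_measurable.
move: (condexp mu A f) => h mRe mIm.
have mz (r : X -> R) : fun_measurable_for A r -> <<s A >> [set x | r x == 0].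
  move=> mr; have := @measurable_fun_eqr _ (g_sigma_algebraType A) R setT r
    (cst 0) mr (measurable_cst _) measurableT [set true] I.
  by rewrite setTI.
have -> : [set x | h x != 0] =
    ~` ([set x | complex.Re (h x) == 0] `&` [set x | complex.Im (h x) == 0]).
  apply/seteqP; split => x /=.
    move=> /negP h0 [r0 i0]; apply: h0.
    by rewrite eq_complex r0 i0.
  by move=> h0; apply/eqP => hx; apply: h0; rewrite hx.
apply: (@measurableC _ (g_sigma_algebraType A)).
by apply: (@measurableI _ (g_sigma_algebraType A)); exact: mz.
Qed.

(** * Conditional expectation when A is everything up to null sets *)

(** A nonnegative f is the supremum of q 1_{f > q} over the nonnegative rationals q;
replacing each level set by an a.e. equal set of [A] changes f only on a countable
union of null sets. *)
Lemma ae_equal_sigma_algebra_approx d (X : measurableType d) (R : realType)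
    (mu : {measure set X -> \bar R}) (A : set_system X) (f : X -> R) :
  ae_equal_sigma_algebra mu A -> measurable_fun setT f -> (forall x, 0 <= f x) ->
  exists g : X -> \bar R, [/\ fun_measurable_for A g, forall x, (0 <= g x)%E &
    {ae mu, forall x, g x = (f x)%:E}].
Proof.
move=> dA mf f0.
(* The absolute value makes every natural number code a nonnegative level. *)
pose c n : R := `|ratr (odflt 0 (unpickle n : option rat))|.
have mL n : measurable [set x | c n < f x].
  have := @measurable_fun_ltr _ X R setT (cst (c n)) f (measurable_cst _) mf
    measurableT [set true] I.
  by rewrite setTI.
pose B n := projT1 (cid2 (dA _ (mL n))).
have AB n : A (B n) by rewrite /B; case: cid2.
have LB n : {ae mu, forall x, c n < f x <-> B n x} by rewrite /B; case: cid2.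
pose t x n : \bar R := (c n * \1_(B n) x)%:E.
have t0 x n : (0 <= t x n)%E by rewrite lee_fin mulr_ge0 ?normr_ge0 ?indicE ?ler0n.
exists (fun x => esups (t x) 0%N); split.
- apply: (@measurable_fun_esups _ (g_sigma_algebraType A) R setT
    (fun n x => t x n)) => n.
  apply/measurable_EFinP; apply: measurable_funM => //.
  apply: (@measurable_indic _ (g_sigma_algebraType A)).
  exact: sub_sigma_algebra.
- move=> x; apply: (le_trans (t0 x 0%N)).
  by apply: ereal_sup_ubound; exists 0%N.
have := ae_foralln LB; apply: filterS => x {}LB.
have tE n : t x n = (if c n < f x then c n else 0)%:E.
  rewrite /t indicE; congr EFin; case: ifPn => cf.
    by rewrite mem_set ?mulr1//; exact/LB.
  by rewrite memNset ?mulr0// => /LB; exact/negP.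
apply/eqP; rewrite eq_le; apply/andP; split.
  apply: ge_ereal_sup => _ [n _ <-]; rewrite tE lee_fin.
  by case: ifPn => // /ltW.
rewrite leNgt; apply/negP => lt_sup.
have sup0 : (0 <= esups (t x) 0%N)%E.
  by apply: (le_trans (t0 x 0%N)); apply: ereal_sup_ubound; exists 0%N.
have le_t n : (t x n <= esups (t x) 0%N)%E by apply: ereal_sup_ubound; exists n.
move: lt_sup sup0 le_t; case: (esups _ _) => [r| |]//.
rewrite lte_fin lee_fin => rf r0 le_t.
have [q] := rat_in_itvoo rf; rewrite in_itv/= => /andP[rq qf].
have := le_t (pickle q); rewrite tE /c pickleK /=.
rewrite ger0_norm; last exact: (le_trans r0 (ltW rq)).
by rewrite qf lee_fin leNgt rq.
Qed.

Lemma ae_eq_set_integral d (X : measurableType d) (R : realType)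
    (mu : {measure set X -> \bar R}) (B B' : set X) (f : X -> \bar R) :
  measurable B -> measurable B' -> {ae mu, forall x, B x <-> B' x} ->
  measurable_fun setT f -> (forall x, 0 <= f x)%E ->
  (\int[mu]_(x in B) f x = \int[mu]_(x in B') f x)%E.
Proof.
move=> mB mB' BB' mf f0; rewrite integral_mkcond [RHS]integral_mkcond.
have mr C : measurable C -> measurable_fun setT (f \_ C).
  by move=> mC; apply/(measurable_restrictT _ _).1 => //; exact: measurable_funTS.
apply: ge0_ae_eq_integral => //; try exact: mr.
- by move=> x _; exact: erestrict_ge0.
- by move=> x _; exact: erestrict_ge0.
move: BB'; apply: filterS => x BB' _; rewrite /patch.
by congr (if _ then _ else _); apply/idP/idP; rewrite !inE => /BB'.
Qed.

(** With F n increasing to X and of finite measure, the sets {x in F n | f x <= n}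
exhaust X, and f is integrable on each of them; so uniqueness of densities of integrable functions
applies, although g may a priori be infinite. *)
Lemma integral_eq_ae_eq d (X : measurableType d) (R : realType)
    (mu : {sigma_finite_measure set X -> \bar R}) (f : X -> R)
    (g : X -> \bar R) :
  measurable_fun setT f -> (forall x, 0 <= f x) -> measurable_fun setT g ->
  (forall B, measurable B ->
    \int[mu]_(x in B) (f x)%:E = \int[mu]_(x in B) g x)%E ->
  {ae mu, forall x, g x = (f x)%:E}.
Proof.
move=> mf f0 mg fg.
have /sigma_finiteP[F [FT ndF Ffin]] := @sigma_finiteT _ _ _ mu.
pose D n := F n `&` [set x | f x <= n%:R].
have mD n : measurable (D n).
  apply: measurableI; first exact: (Ffin n).1.
  have := @measurable_fun_ler _ X R setT f (cst n%:R) mf (measurable_cst _)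
    measurableT [set true] I.
  by rewrite setTI.
have Dfg n : {ae mu, forall x, D n x -> (f x)%:E = g x}.
  apply: (integral_ae_eq (mD n)).
  - apply: measurable_bounded_integrable => //.
    + apply: le_lt_trans (Ffin n).2; apply: le_measure => //.
      * by rewrite inE.
      * by rewrite inE; exact: (Ffin n).1.
      * exact: subIsetl.
    + exact: measurable_funTS.
    + exists n%:R; split; first exact: num_real.
      move=> M nM x [_ /= fn]; rewrite ger0_norm//.
      exact: le_trans fn (ltW nM).
  - exact: measurable_funTS.
  - by move=> E _; exact: fg.
have := ae_foralln Dfg; apply: filterS => x {}Dfg.
have [k _ Fk] : (\bigcup_i F i) x by rewrite -FT.
have [m fm] : exists m : nat, f x <= m%:R.
  exists (Num.bound (f x)); exact/ltW/archi_boundP.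
apply/esym/(Dfg (maxn k m)); split.
  exact: (subsetPset _ _ (ndF k (maxn k m) (leq_maxl k m))).
by rewrite /= (le_trans fm)// ler_nat leq_maxr.
Qed.

(** Since every measurable set is a.e. equal to one of [A], f and g have the same
integral over every measurable set. *)
Lemma is_condexp_ae_eq d (X : measurableType d) (R : realType)
    (mu : {sigma_finite_measure set X -> \bar R}) (A : set_system X)
    (f : X -> R) (g : X -> \bar R) :
  A `<=` measurable -> ae_equal_sigma_algebra mu A ->
  measurable_fun setT f -> (forall x, 0 <= f x) ->
  is_condexp mu A (EFin \o f) g -> {ae mu, forall x, g x = (f x)%:E}.
Proof.
move=> AX dA mf f0 [mg g0 fg].
have {}mg : measurable_fun setT g by exact: fun_measurable_forW mg.
apply: integral_eq_ae_eq => // B mB.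
have [B' AB' BB'] := dA _ mB.
have mEf : measurable_fun setT (EFin \o f) by exact/measurable_EFinP.
have Ef0 x : (0 <= (EFin \o f) x)%E by rewrite lee_fin.
rewrite (ae_eq_set_integral mB (AX _ AB') BB' mEf Ef0).
by rewrite (ae_eq_set_integral mB (AX _ AB') BB' mg g0); exact: fg.
Qed.

(** The A-measurable function a.e. equal to f satisfies [is_condexp], so the choice
operator in [condexp_ge0] returns a genuine conditional expectation. *)
Lemma condexp_ge0_id d (X : measurableType d) (R : realType)
    (mu : {sigma_finite_measure set X -> \bar R}) (A : set_system X)
    (f : X -> R) :
  A `<=` measurable -> ae_equal_sigma_algebra mu A ->
  measurable_fun setT f -> (forall x, 0 <= f x) ->
  {ae mu, forall x, condexp_ge0 mu A (EFin \o f) x = (f x)%:E}.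
Proof.
move=> AX dA mf f0; apply: (is_condexp_ae_eq AX) => //.
rewrite /condexp_ge0.
apply: (@xgetPex _ _ [set g | is_condexp mu A (EFin \o f) g]).
have [g [mg g0 gf]] := ae_equal_sigma_algebra_approx dA mf f0.
exists g; split=> // B /AX mB.
have mg' : measurable_fun setT g by exact: fun_measurable_forW mg.
apply: ge0_ae_eq_integral => //.
- by apply/measurable_EFinP; exact: measurable_funTS.
- exact: measurable_funTS.
- by move=> x _; rewrite lee_fin.
by move: gf; apply: filterS => x gf _; rewrite gf.
Qed.

Lemma condexp_id d (X : measurableType d) (R : realType)
    (mu : {sigma_finite_measure set X -> \bar R}) (A : set_system X)
    (f : X -> R[i]) :
  A `<=` measurable -> ae_equal_sigma_algebra mu A -> cmeasurable f ->
  condexp mu A f = f %[ae mu].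
Proof.
move=> AX dA [mRe mIm].
have id_real (r : X -> R) : measurable_fun setT r ->
    {ae mu, forall x, condexp_real mu A r x = r x}.
  move=> mr.
  have := condexp_ge0_id AX dA (measurable_funrneg mr) (funrneg_ge0 r).
  have := condexp_ge0_id AX dA (measurable_funrpos mr) (funrpos_ge0 r).
  apply: filterS2 => x rp rn; rewrite /condexp_real rp rn /=.
  by have /(congr1 (@^~ x)) := funrposBneg r.
have := id_real _ mIm; have := id_real _ mRe.
by apply: filterS2 => x fRe fIm _; rewrite /condexp fRe fIm; case: (f x).
Qed.

(** * Surjectivity forces A to be everything up to null sets *)

Lemma inL2_indic d (X : measurableType d) (R : realType)
    (mu : {measure set X -> \bar R}) (B : set X) :
  measurable B -> (mu B < +oo)%E -> inL2 mu (fun x => (\1_B x : R)%:C).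
Proof.
move=> mB Bfin; split; first by split => //; exact: measurable_indic.
rewrite /L2norm unlock; apply: poweR_lty.
rewrite (eq_integral (fun x => (\1_B x)%:E)); last first.
  move=> x _; rewrite /cabs /= expr0n /= addr0 sqrtr_sqr normr_id.
  rewrite indicE; case: (x \in B) => /=.
    by rewrite normr1 powR1.
  by rewrite normr0 powR0// pnatr_eq0.
by rewrite integral_indic// setIT.
Qed.

(** Write 1_B = T g = w h with h = E(u g) for B of finite measure: B is a.e. the set
where both w and h are nonzero.  Over an exhausting sequence of sets of finite
measure this gives w <> 0 a.e., after which the condition on w can be dropped. *)
Lemma weighted_condexp_onto_ae_equal d (X : measurableType d) (R : realType)
    (mu : {sigma_finite_measure set X -> \bar R}) (A : set_system X)
    (w u : X -> R[i]) :
  sigma_algebra setT A ->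
  (forall f, inL2 mu f ->
    exists g, weighted_condexp mu A w u g = f %[ae mu]) ->
  ae_equal_sigma_algebra mu A.
Proof.
move=> sA onto.
have indic_range (B : set X) : measurable B -> (mu B < +oo)%E ->
    exists g, {ae mu, forall x, B x <-> w x != 0 /\ condexp mu A g x != 0}.
  move=> mB Bfin; have [g Tg] := onto _ (inL2_indic mB Bfin).
  exists (fun y => u y * g y); move: Tg; apply: filterS => x /(_ I).
  rewrite /weighted_condexp; set h := condexp _ _ _ _ => Tg.
  have -> : (w x != 0 /\ h != 0) <-> (\1_B x : R)%:C != 0.
    by rewrite -Tg mulf_eq0 negb_or; split=> [[-> ->]|/andP].
  rewrite indicE; have [xB|xB] := pselect (B x).
    by rewrite mem_set//= oner_eq0.
  by rewrite memNset//= eqxx; split.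
have /sigma_finiteP[F [FT ndF Ffin]] := @sigma_finiteT _ _ _ mu.
have w0 : {ae mu, forall x, w x != 0}.
  have wF n : {ae mu, forall x, F n x -> w x != 0}.
    have [g] := indic_range _ (Ffin n).1 (Ffin n).2.
    by apply: filterS => x Fx /Fx[].
  have := ae_foralln wF; apply: filterS => x {}wF.
  have [k _ Fk] : (\bigcup_i F i) x by rewrite -FT.
  exact: wF Fk.
move=> B mB.
have mBF n : measurable (B `&` F n) by apply: measurableI => //; exact: (Ffin n).1.
have BFfin n : (mu (B `&` F n) < +oo)%E.
  apply: le_lt_trans (Ffin n).2; apply: le_measure => //.
  - rewrite inE; exact: mBF.
  - by rewrite inE; exact: (Ffin n).1.
have [g gP] := choice (fun n => indic_range _ (mBF n) (BFfin n)).
exists (\bigcup_n [set x | condexp mu A (g n) x != 0]).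
  have [_ _] := sA; apply => n; exact: condexp_neq0_measurable.
have := ae_foralln gP; apply: filterS2 w0 => x wx {}gP; split.
  move=> Bx; have [k _ Fk] : (\bigcup_i F i) x by rewrite -FT.
  by exists k => //; have [/(_ (conj Bx Fk))[]] := gP k.
by move=> [n _ hx]; have [_ /(_ (conj wx hx))[]] := gP n.
Qed.

(** * Multiplication operators *)

Lemma cmeasurableM d (X : measurableType d) (R : realType) (f g : X -> R[i]) :
  cmeasurable f -> cmeasurable g -> cmeasurable (fun x => f x * g x).
Proof.
move=> [fRe fIm] [gRe gIm]; split.
- rewrite (_ : (fun x => _) = (fun x => complex.Re (f x) * complex.Re (g x) -
      complex.Im (f x) * complex.Im (g x))).
    by apply: measurable_funB; exact: measurable_funM.
  by apply/funext => x; case: (f x) => a b; case: (g x).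
- rewrite (_ : (fun x => _) = (fun x => complex.Re (f x) * complex.Im (g x) +
      complex.Im (f x) * complex.Re (g x))).
    by apply: measurable_funD; exact: measurable_funM.
  by apply/funext => x; case: (f x) => a b; case: (g x).
Qed.

Lemma cmeasurable_conjc d (X : measurableType d) (R : realType)
    (f : X -> R[i]) : cmeasurable f -> cmeasurable (fun x => conjc (f x)).
Proof.
move=> [fRe fIm]; split.
  by rewrite (_ : (fun x => _) = (fun x => complex.Re (f x)))//;
    apply/funext => x; case: (f x).
rewrite (_ : (fun x => _) = (fun x => - complex.Im (f x))).
  exact: measurable_funN.
by apply/funext => x; case: (f x).
Qed.

Lemma cabs_measurable d (X : measurableType d) (R : realType)
    (f : X -> R[i]) : cmeasurable f -> measurable_fun setT (cabs f).
Proof.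
move=> [fRe fIm]; apply/measurable_EFinP.
rewrite (_ : (fun x => _) = (fun x => Num.sqrt
    (complex.Re (f x) ^+ 2 + complex.Im (f x) ^+ 2))); last first.
  by apply/funext => x; case: (f x).
apply: (measurableT_comp (continuous_measurable_fun (@sqrt_continuous R))).
by apply: measurable_funD; exact: measurable_funX.
Qed.

Lemma cabs_conjM d (X : measurableType d) (R : realType) (f g : X -> R[i]) :
  cabs (fun x => conjc (f x) * g x) = cabs (fun x => f x * g x).
Proof.
apply/funext => x; rewrite /cabs !Normc.normcM; congr (_ * _)%:E.
by case: (f x) => a b /=; rewrite sqrrN.
Qed.

Lemma ae_eq_L2norm d (X : measurableType d) (R : realType)
    (mu : {measure set X -> \bar R}) (f g : X -> R[i]) :
  cmeasurable f -> cmeasurable g -> f = g %[ae mu] ->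
  L2norm mu f = L2norm mu g.
Proof.
move=> mf mg fg; rewrite /L2norm unlock; congr (_ `^ _)%E.
have m2 (h : X -> R[i]) : cmeasurable h ->
    measurable_fun setT (fun x => (`|cabs h x| `^ (2%R : R))%E).
  move=> mh; apply: (measurableT_comp (measurable_poweR _)).
  exact: measurableT_comp (cabs_measurable mh).
apply: ae_eq_integral; [by []|exact: m2|exact: m2|].
move: fg; apply: filterS => x fgx _.
by rewrite /cabs (fgx I).
Qed.

Lemma ae_eq_inner d (X : measurableType d) (R : realType)
    (mu : {measure set X -> \bar R}) (f g f' g' : X -> R[i]) :
  cmeasurable f -> cmeasurable g -> cmeasurable f' -> cmeasurable g' ->
  (fun x => f x * conjc (g x)) = (fun x => f' x * conjc (g' x)) %[ae mu] ->
  inner mu f g = inner mu f' g'.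
Proof.
move=> mf mg mf' mg' fg.
have [mRe mIm] := cmeasurableM mf (cmeasurable_conjc mg).
have [mRe' mIm'] := cmeasurableM mf' (cmeasurable_conjc mg').
rewrite /inner /Rintegral; congr (fine _ +i* fine _).
- apply: ae_eq_integral => //; try exact/measurable_EFinP.
  by move: fg; apply: filterS => x fgx _; rewrite (fgx I).
- apply: ae_eq_integral => //; try exact/measurable_EFinP.
  by move: fg; apply: filterS => x fgx _; rewrite (fgx I).
Qed.

(** The candidate adjoint f |-> conj(v) f inherits boundedness from T because |conj(v) f|
= |v f| pointwise. *)
Lemma multiplication_operator_normal d (X : measurableType d) (R : realType)
    (mu : {measure set X -> \bar R}) (v : X -> R[i])
    (T : (X -> R[i]) -> X -> R[i]) :
  cmeasurable v -> bounded_operator mu T ->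
  (forall f, inL2 mu f -> T f = (fun x => v x * f x) %[ae mu]) ->
  normal_operator mu T.
Proof.
move=> mv [TL2 _ _ [M TM]] Tv.
pose S (f : X -> R[i]) x := conjc (v x) * f x.
have mS f : cmeasurable f -> cmeasurable (S f).
  by move=> mf; apply: cmeasurableM => //; exact: cmeasurable_conjc.
have SE f : inL2 mu f -> L2norm mu (S f) = L2norm mu (T f).
  move=> fL2; rewrite /L2norm /S cabs_conjM; apply/esym/ae_eq_L2norm.
  - exact: (TL2 _ fL2).1.
  - exact: cmeasurableM fL2.1.
  - exact: Tv.
have SL2 f : inL2 mu f -> inL2 mu (S f).
  by move=> fL2; split; [exact: mS fL2.1|rewrite SE//; exact: (TL2 _ fL2).2].
exists S; split; first split.
- split => //.
  + by move=> f g _ _; apply: filterS => x fg /fg; rewrite /S => ->.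
  + move=> a b f g _ _; apply: aeW => x _.
    by rewrite /S mulrDr; congr (_ + _); rewrite mulrCA.
  + by exists M => f fL2; rewrite SE//; exact: TM.
- move=> f g fL2 gL2; apply: ae_eq_inner.
  + exact: (TL2 _ fL2).1.
  + exact: gL2.1.
  + exact: fL2.1.
  + exact: mS gL2.1.
  + move: (Tv _ fL2); apply: filterS => x Tf _.
    by rewrite Tf// /S rmorphM /= conjcK mulrA [f x * v x]mulrC.
move=> f fL2; move: (Tv _ (SL2 _ fL2)) (Tv _ fL2).
by apply: filterS2 => x TS Tf _; rewrite TS// /S Tf// mulrCA.
Qed.

(** * Normality *)

Theorem theorem2p3 (d : measure_display) (X : measurableType d) (R : realType)
    (mu : {sigma_finite_measure set X -> \bar R}) (A : set_system X)
    (mu_complete : measure_is_complete mu)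
    (subA : is_sub_sigma_algebra A)
    (sfA : sigma_finite_on mu A)
    (u w : X -> R[i])
    (uE : in_dom_condexp mu A u)
    (wE : in_dom_condexp mu A w)
    (Tbounded : bounded_weighted_condexp mu A w u)
    (Tinv : invertible_operator mu (weighted_condexp mu A w u)) :
  normal_operator mu (weighted_condexp mu A w u).
Proof.
have [sA AX] := subA; have [umeas _] := uE; have [wmeas _] := wE.
have [_ Tbnd] := Tbounded.
have dA : ae_equal_sigma_algebra mu A.
  apply: (@weighted_condexp_onto_ae_equal _ _ _ _ _ w u) => // f fL2.
  by have [S [_ /(_ f fL2)[_ TS]]] := Tinv; exists (S f).
apply: (@multiplication_operator_normal _ _ _ _ (fun x => w x * u x)) => //.
  exact: cmeasurableM.
move=> f [mf _]; have := condexp_id AX dA (cmeasurableM umeas mf).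
by apply: filterS => x Ex _; rewrite /weighted_condexp Ex// mulrA.
Qed.
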